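(* Let $T>0$, let $k_1,k_2,a,b>0$ be constants, let $0<\varepsilon\ll 1$ be a small parameter, and let $H=\{(x,t): |x|<\infty,\ 0\le t\le T\}$. Let $f=f(u,v)\in C^\infty(\mathbb{R}^2)$ be real-valued, and let $\overset{0}{u},\varphi\in C^\infty(\mathbb{R})$ satisfy $|\overset{0}{u}(x)|<Ce^{-\kappa x^2}$ and $|\varphi(x)|<Ce^{-\kappa x^2}$ for all $x\in\mathbb{R}$, with some constants $C,\kappa>0$. Consider the Cauchy problem on $H$ $$\begin{cases} \varepsilon^3(u_{tt}-k_1u_{xx})=-au+bv+\varepsilon^2 f(u,v),\\ \varepsilon^3(v_{tt}-k_2v_{xx})=au-bv-\varepsilon^2 f(u,v),\end{cases}\qquad \begin{cases} u(x,0)=\overset{0}{u}(x),\quad u_t(x,0)=\varphi(x),\\ v(x,0)=\frac{a}{b}\overset{0}{u}(x),\quad v_t(x,0)=\frac{a}{b}\varphi(x).\end{cases}$$ Let $(\bar u_0,\bar v_0)$ be the principal terms defined in the context. Then the solution $(u,v)$ of this Cauchy problem can be represented on $H$ in the form $$\begin{pmatrix} u(x,t,\varepsilon)\\ v(x,t,\varepsilon)\end{pmatrix}=\begin{pmatrix}\bar u_0(x,t)\\ \bar v_0(x,t)\end{pmatrix}+\begin{pmatrix} Ru(x,t,\varepsilon)\\ Rv(x,t,\varepsilon)\end{pmatrix},$$ where $(Ru,Rv)$ is a solution of the problem $$\begin{cases} \varepsilon^3(Ru_{tt}-k_1Ru_{xx})=-aRu+bRv+\varepsilon^2 r(Ru,Rv)+r_1,\\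 \varepsilon^3(Rv_{tt}-k_2Rv_{xx})=aRu-bRv-\varepsilon^2 r(Ru,Rv)+r_2,\\ Ru(x,0)=0,\quad Ru_t(x,0)=0,\\ Rv(x,0)=0,\quad Rv_t(x,0)=0,\end{cases}$$ in which $$r(Ru,Rv)=f(\bar u_0,\bar v_0)+f(\bar u_0+Ru,\bar v_0+Rv),$$ and $r_1=r_1(x,t,\varepsilon)$, $r_2=r_2(x,t,\varepsilon)$ are functions of $(x,t)\in H$ and $\varepsilon$ (not depending on $Ru,Rv$) such that $r_1(x,t,\varepsilon)=O(\varepsilon^2)$ and $r_2(x,t,\varepsilon)=O(\varepsilon^2)$ as $\varepsilon\to 0$, for $(x,t)\in H$.
   Context: Subscripts $x,t$ denote partial derivatives. $Ru$ and $Rv$ are names of single functions (the two components of the residual term $R$), not products; $Ru_{tt}$ means the second $t$-derivative of $Ru$, and so on. Set $k=\dfrac{bk_1+ak_2}{a+b}$. The principal terms $(\bar u_0,\bar v_0)$ of the regular part of the asymptotic expansion are defined as follows: $\bar u_0(x,t)$ is the solution on $H$ of the Cauchy problem $$\bar u_{0,tt}-k\,\bar u_{0,xx}=0,\qquad \bar u_0(x,0)=\overset{0}{u}(x),\quad \bar u_{0,t}(x,0)=\varphi(x),$$ and $\bar v_0=\dfrac{a}{b}\bar u_0$. The $O(\varepsilon^2)$ relations are understood at points $(x,t)\in H$ as $\varepsilon\to0$. *)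

(* Defs.v *)
From Stdlib Require Import Reals List.
From Coquelicot Require Import Coquelicot.
Import ListNotations.
Open Scope R_scope.

Definition smooth1 (g : R -> R) : Prop :=
  forall n x, ex_derive_n g n x.

Definition smooth2 (g : R -> R -> R) : Prop :=
  forall n x y, ex_diff_n g n x y.

(** The strip [|x| < oo, 0 <= t <= T].  Functions on the strip are total
    functions [w x t], but every predicate below depends only on their values
    on the strip; in particular the derivatives in [t] are one-sided at [t = 0]
    and [t = T]. *)
Definition strip (T : R) (p : R * R) : Prop := 0 <= snd p <= T.

Definition is_dx (T : R) (w wx : R -> R -> R) : Prop :=
  forall x t, strip T (x, t) -> is_derive (fun y => w y t) x (wx x t).

Definition is_dt (T : R) (w wt : R -> R -> R) : Prop :=
  forall x t, strip T (x, t) -> D_in (w x) (wt x) (fun s => 0 <= s <= T) t.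

Definition continuous_strip (T : R) (w : R -> R -> R) : Prop :=
  continuous_on (strip T) (fun p : R * R => w (fst p) (snd p)).

(** [w] is of class C^2 on the strip, with [t]-derivative [wt] and pure second
    derivatives [wxx] and [wtt]. *)
Definition C2_strip (T : R) (w wt wxx wtt : R -> R -> R) : Prop :=
  exists wx wxt wtx : R -> R -> R,
    is_dx T w wx /\ is_dt T w wt /\
    is_dx T wx wxx /\ is_dt T wx wxt /\
    is_dx T wt wtx /\ is_dt T wt wtt /\
    List.Forall (continuous_strip T) [w; wx; wt; wxx; wxt; wtx; wtt].

(** [w] is a classical solution of
    [w_tt - k w_xx = 0], [w(x,0) = w0(x)], [w_t(x,0) = w1(x)]. *)
Definition wave_cauchy (T k : R) (w0 w1 : R -> R) (w : R -> R -> R) : Prop :=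
  exists wt wxx wtt : R -> R -> R,
    C2_strip T w wt wxx wtt /\
    (forall x t, strip T (x, t) -> wtt x t - k * wxx x t = 0) /\
    (forall x, w x 0 = w0 x /\ wt x 0 = w1 x).

(** [(u, v)] is a classical solution of
    [eps^3 (u_tt - k1 u_xx) = F (x, t, u, v)],
    [eps^3 (v_tt - k2 v_xx) = G (x, t, u, v)] with initial values [u0], [v0]
    and initial velocities [u1], [v1]. *)
Definition system_cauchy (T eps k1 k2 : R) (F G : R -> R -> R -> R -> R)
    (u0 u1 v0 v1 : R -> R) (u v : R -> R -> R) : Prop :=
  exists ut uxx utt vt vxx vtt : R -> R -> R,
    C2_strip T u ut uxx utt /\ C2_strip T v vt vxx vtt /\
    (forall x t, strip T (x, t) ->
       eps ^ 3 * (utt x t - k1 * uxx x t) = F x t (u x t) (v x t) /\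
       eps ^ 3 * (vtt x t - k2 * vxx x t) = G x t (u x t) (v x t)) /\
    (forall x, u x 0 = u0 x /\ ut x 0 = u1 x /\ v x 0 = v0 x /\ vt x 0 = v1 x).

(** [g(x, t, eps) = O(eps^2)] as [eps -> 0+], at each point of the strip; the
    constants may depend on the point. *)
Definition bigO_eps2 (T : R) (g : R -> R -> R -> R) : Prop :=
  forall x t, strip T (x, t) ->
    exists M delta : R, 0 < delta /\
      forall eps, 0 < eps < delta -> Rabs (g x t eps) <= M * eps ^ 2.

(* Main.v *)
Require Import Defs.
From Stdlib Require Import Reals List Lra.
From Coquelicot Require Import Coquelicot.
Open Scope R_scope.

(** The remainder is [Ru = u - ubar], [Rv = v - vbar].  Since
    [- a ubar + b vbar = 0], it satisfies the equations of the solution with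
    the extra source terms [- eps^3 (ubar_tt - k1 ubar_xx)] and
    [- eps^3 (vbar_tt - k2 vbar_xx)].  Replacing [f (u, v)] by [r (Ru, Rv)]
    costs [-+ eps^2 f (ubar, vbar)], so these terms together are
    [O(eps^2)]. *)

Lemma is_dx_minus (T : R) (w z wx zx : R -> R -> R) :
  is_dx T w wx -> is_dx T z zx ->
  is_dx T (fun x t => w x t - z x t) (fun x t => wx x t - zx x t).
Proof.
intros hw hz x t hs.
exact (is_derive_minus _ _ _ _ _ (hw x t hs) (hz x t hs)).
Qed.

Lemma is_dx_scal (T c : R) (w wx : R -> R -> R) :
  is_dx T w wx -> is_dx T (fun x t => c * w x t) (fun x t => c * wx x t).
Proof.
intros hw x t hs.
exact (is_derive_scal _ _ c _ (hw x t hs)).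
Qed.

Lemma is_dt_minus (T : R) (w z wt zt : R -> R -> R) :
  is_dt T w wt -> is_dt T z zt ->
  is_dt T (fun x t => w x t - z x t) (fun x t => wt x t - zt x t).
Proof.
intros hw hz x t hs.
exact (Dminus _ _ _ _ _ t (hw x t hs) (hz x t hs)).
Qed.

Lemma is_dt_scal (T c : R) (w wt : R -> R -> R) :
  is_dt T w wt -> is_dt T (fun x t => c * w x t) (fun x t => c * wt x t).
Proof.
intros hw x t hs.
exact (Dmult_const _ _ _ t c (hw x t hs)).
Qed.

Lemma continuous_strip_minus (T : R) (w z : R -> R -> R) :
  continuous_strip T w -> continuous_strip T z ->
  continuous_strip T (fun x t => w x t - z x t).
Proof.
intros hw hz p hp.
(* Subtraction unfolds to addition of the opposite, so the limit of [- z] is taken first and then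
   added to that of [w]. *)
pose proof (filterlim_comp _ _ _ _ _ _ _ _ (hz p hp)
  (filterlim_opp (V := R_NormedModule) (z (fst p) (snd p)))) as hz'.
exact (filterlim_comp_2 _ _ _ (hw p hp) hz'
  (filterlim_plus (V := R_NormedModule) _ _)).
Qed.

Lemma continuous_strip_scal (T c : R) (w : R -> R -> R) :
  continuous_strip T w -> continuous_strip T (fun x t => c * w x t).
Proof.
intros hw p hp.
exact (filterlim_comp _ _ _ _ _ _ _ _ (hw p hp)
  (filterlim_scal_r (V := R_NormedModule) c (w (fst p) (snd p)))).
Qed.

(** Carries the regularity of the solution and of the principal term over to the remainder, and at
    the same time names the derivatives that enter its equations. *)
Lemma C2_strip_minus (T : R) (w wt wxx wtt z zt zxx ztt : R -> R -> R) :
  C2_strip T w wt wxx wtt -> C2_strip T z zt zxx ztt ->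
  C2_strip T (fun x t => w x t - z x t) (fun x t => wt x t - zt x t)
    (fun x t => wxx x t - zxx x t) (fun x t => wtt x t - ztt x t).
Proof.
intros (wx & wxt & wtx & w1 & w2 & w3 & w4 & w5 & w6 & hw)
  (zx & zxt & ztx & z1 & z2 & z3 & z4 & z5 & z6 & hz).
exists (fun x t => wx x t - zx x t), (fun x t => wxt x t - zxt x t),
  (fun x t => wtx x t - ztx x t).
repeat apply conj; try (now apply is_dx_minus); try (now apply is_dt_minus).
rewrite !Forall_cons_iff in hw, hz.
repeat (apply Forall_cons; [apply continuous_strip_minus; tauto|]).
apply Forall_nil.
Qed.

(** Used with [c = a / b] to get the regularity of [vbar] from that of [ubar]. *)
Lemma C2_strip_scal (T c : R) (w wt wxx wtt : R -> R -> R) :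
  C2_strip T w wt wxx wtt ->
  C2_strip T (fun x t => c * w x t) (fun x t => c * wt x t)
    (fun x t => c * wxx x t) (fun x t => c * wtt x t).
Proof.
intros (wx & wxt & wtx & w1 & w2 & w3 & w4 & w5 & w6 & hw).
exists (fun x t => c * wx x t), (fun x t => c * wxt x t),
  (fun x t => c * wtx x t).
repeat apply conj; try (now apply is_dx_scal); try (now apply is_dt_scal).
rewrite !Forall_cons_iff in hw.
repeat (apply Forall_cons; [apply continuous_strip_scal; tauto|]).
apply Forall_nil.
Qed.

(** Both source terms have this shape. Since the constants may depend on the point, the values of
    [g] and [h] there suffice and no uniform bound is involved. *)
Lemma bigO_eps2_pow2_pow3 (T : R) (g h : R -> R -> R) :
  bigO_eps2 T (fun x t eps => eps ^ 2 * g x t + eps ^ 3 * h x t).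
Proof.
(* After [eps ^ 2] is factored out, [eps < 1] absorbs the remaining factor [eps] in front of [h]. *)
intros x t _; exists (Rabs (g x t) + Rabs (h x t)), 1; split; [lra|].
intros eps heps.
replace (eps ^ 2 * g x t + eps ^ 3 * h x t)
  with ((g x t + eps * h x t) * eps ^ 2) by ring.
rewrite Rabs_mult, (Rabs_pos_eq (eps ^ 2)) by (apply pow2_ge_0).
apply Rmult_le_compat_r; [apply pow2_ge_0|].
eapply Rle_trans; [apply Rabs_triang|].
apply Rplus_le_compat_l.
rewrite Rabs_mult, (Rabs_pos_eq eps) by lra.
rewrite <- (Rmult_1_l (Rabs (h x t))) at 2.
apply Rmult_le_compat_r; [apply Rabs_pos | lra].
Qed.

Theorem mainTheorem1 (T k1 k2 a b : R) (f : R -> R -> R) (u0 phi : R -> R)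
  (C kappa : R) (ubar : R -> R -> R)
  (hT : 0 < T) (hk1 : 0 < k1) (hk2 : 0 < k2) (ha : 0 < a) (hb : 0 < b)
  (hf : smooth2 f) (hu0 : smooth1 u0) (hphi : smooth1 phi)
  (hC : 0 < C) (hkappa : 0 < kappa)
  (hu0_decay : forall x, Rabs (u0 x) < C * exp (- kappa * x ^ 2))
  (hphi_decay : forall x, Rabs (phi x) < C * exp (- kappa * x ^ 2))
  (hubar : wave_cauchy T ((b * k1 + a * k2) / (a + b)) u0 phi ubar) :
  let vbar := fun x t => a / b * ubar x t in
  let r := fun x t p q =>
    f (ubar x t) (vbar x t) + f (ubar x t + p) (vbar x t + q) in
  exists r1 r2 : R -> R -> R -> R,
    bigO_eps2 T r1 /\ bigO_eps2 T r2 /\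
    forall (eps : R), 0 < eps ->
    forall (u v : R -> R -> R),
      system_cauchy T eps k1 k2
        (fun x t p q => - a * p + b * q + eps ^ 2 * f p q)
        (fun x t p q => a * p - b * q - eps ^ 2 * f p q)
        u0 phi (fun x => a / b * u0 x) (fun x => a / b * phi x)
        u v ->
      exists Ru Rv : R -> R -> R,
        (forall x t, strip T (x, t) ->
           u x t = ubar x t + Ru x t /\ v x t = vbar x t + Rv x t) /\
        system_cauchy T eps k1 k2
          (fun x t p q =>
             - a * p + b * q + eps ^ 2 * r x t p q + r1 x t eps)
          (fun x t p q =>
             a * p - b * q - eps ^ 2 * r x t p q + r2 x t eps)
          (fun _ => 0) (fun _ => 0) (fun _ => 0) (fun _ => 0)
          Ru Rv.
Proof.
intros vbar r.
destruct hubar as (ubt & ubxx & ubtt & hC2 & _ & hinit).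
(* The sources involve only [ubar], its derivatives and [eps], so they can be fixed before [u] and
   [v]. The [eps ^ 2] parts cancel the extra summand [f (ubar, vbar)] of [r]; in the second source
   the derivatives of [vbar] appear as [a / b] times those of [ubar]. *)
exists (fun x t eps => eps ^ 2 * - f (ubar x t) (vbar x t)
    + eps ^ 3 * - (ubtt x t - k1 * ubxx x t)),
  (fun x t eps => eps ^ 2 * f (ubar x t) (vbar x t)
    + eps ^ 3 * - (a / b * (ubtt x t - k2 * ubxx x t))).
split; [apply bigO_eps2_pow2_pow3|].
split; [apply (bigO_eps2_pow2_pow3 T (fun x t => f (ubar x t) (vbar x t)))|].
intros eps heps u v
  (ut & uxx & utt & vt & vxx & vtt & hu & hv & heq & hinituv).
exists (fun x t => u x t - ubar x t), (fun x t => v x t - vbar x t).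
split; [intros; split; ring|].
(* The six derivatives are left open here; the two regularity facts that follow determine them as
   differences. *)
do 6 eexists.
split; [exact (C2_strip_minus _ _ _ _ _ _ _ _ _ hu hC2)|].
split; [exact (C2_strip_minus _ _ _ _ _ _ _ _ _ hv
  (C2_strip_scal _ (a / b) _ _ _ _ hC2))|].
split.
- intros x t hs; cbv beta.
  destruct (heq x t hs) as [equ eqv].
  unfold r.
  replace (ubar x t + (u x t - ubar x t)) with (u x t) by ring.
  replace (vbar x t + (v x t - vbar x t)) with (v x t) by ring.
  (* The principal terms balance the reaction terms of order one. With this, the remainder equations
     are linear consequences of those for [u] and [v], the nonlinear products being treated as
     atoms. *)
  assert (hbal : b * vbar x t = a * ubar x t)
    by (unfold vbar; field; lra).
  split; lra.
(* The principal terms take the full initial data, the factor [a / b] matching that of [v], so the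
   differences vanish. *)
- intros x.
  destruct (hinit x) as [i0 i1].
  destruct (hinituv x) as (j0 & j1 & j2 & j3).
  unfold vbar; rewrite i0, i1, j0, j1, j2, j3.
  repeat split; ring.
Qed.
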